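(* Let $\mathbf{T}=(T,\eta,\mu)$ be a monad on $\mathbf{Set}$ and let $F\colon \mathbf{Set}\to\mathbf{Set}$ be an endofunctor which has a final coalgebra and which has a $\mathbf{T}$-algebra lifting $F^*$. Assume moreover that the functor $FT$ has a final coalgebra (so that $\sim_{FT}$ is defined). Then for all $FT$-coalgebras $(X,f)$, $(Y,g)$ and all states $x\in X$, $y\in Y$: if $x\sim_{FT} y$ then $x\approx_F^T y$.
   Context: For a functor $G\colon\mathbf{Set}\to\mathbf{Set}$, a $G$-coalgebra is a pair $(X,f\colon X\to G(X))$; a $G$-homomorphism $h\colon (X,f)\to(Y,g)$ is a function with $g\circ h=G(h)\circ f$. A $G$-coalgebra $(\Omega,\omega)$ is final if every $G$-coalgebra $(X,f)$ has a unique homomorphism $[\![-]\!]_X\colon X\to\Omega$. When $G$ has a final coalgebra, states $x\in X$, $y\in Y$ of $G$-coalgebras $(X,f)$, $(Y,g)$ are behaviourally equivalent, written $x\sim_G y$, iff $[\![x]\!]_X=[\![y]\!]_Y$. A $\mathbf{T}$-algebra is a pair $(A,h\colon T(A)\to A)$ with $h\circ\mu_A=h\circ T(h)$ and $h\circ\eta_A=\mathrm{id}_A$; these with $\mathbf{T}$-homomorphisms form the Eilenberg–Moore category $\mathbf{Set}^{\mathbf{T}}$ with forgetful functor $U^{\mathbf{T}}\colon\mathbf{Set}^{\mathbf{T}}\to\mathbf{Set}$. A $\mathbf{T}$-algebra lifting of $F$ is an endofunctor $F^*\colon\mathbf{Set}^{\mathbf{T}}\to\mathbf{Set}^{\mathbf{T}}$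 with $U^{\mathbf{T}}\circ F^*=F\circ U^{\mathbf{T}}$. In that case, for each set $X$, $F^*(T(X),\mu_X)$ is a $\mathbf{T}$-algebra of the form $(FT(X),h_X)$. Given an $FT$-coalgebra $(X,f\colon X\to FT(X))$, let $f^\sharp=h_X\circ T(f)\colon T(X)\to FT(X)$ be the unique $\mathbf{T}$-algebra homomorphism $(T(X),\mu_X)\to(FT(X),h_X)$ with $f^\sharp\circ\eta_X=f$; thus $(T(X),f^\sharp)$ is an $F$-coalgebra. For $FT$-coalgebras $(X,f)$, $(Y,g)$ and $x\in X$, $y\in Y$, define $x\approx_F^T y$ iff $\eta_X(x)\sim_F\eta_Y(y)$, where $\sim_F$ is behavioural equivalence between the $F$-coalgebras $(T(X),f^\sharp)$ and $(T(Y),g^\sharp)$. *)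

(* Defs.v *)
From Stdlib Require Import ProofIrrelevance.

Record Category := {
  Obj :> Type;
  Hom : Obj -> Obj -> Type;
  idm : forall A, Hom A A;
  comp : forall A B C, Hom B C -> Hom A B -> Hom A C;
  comp_idl : forall A B (f : Hom A B), comp A B B (idm B) f = f;
  comp_idr : forall A B (f : Hom A B), comp A A B f (idm A) = f;
  comp_assoc : forall A B C D (h : Hom C D) (g : Hom B C) (f : Hom A B),
    comp A C D h (comp A B C g f) = comp A B D (comp B C D h g) f
}.
Arguments Hom {c} A B : rename.
Arguments idm {c} A : rename.
Arguments comp {c A B C} g f : rename.
Arguments comp_assoc {c A B C D} h g f : rename.

Notation "g ∘ f" := (comp g f) (at level 40, left associativity).

Record Functor (C D : Category) := {
  fobj :> C -> D;
  fmap : forall A B : C, Hom A B -> Hom (fobj A) (fobj B);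
  fmap_id : forall A : C, fmap A A (idm A) = idm (fobj A);
  fmap_comp : forall (A B E : C) (g : Hom B E) (f : Hom A B),
    fmap A E (g ∘ f) = fmap B E g ∘ fmap A B f
}.
Arguments fobj {C D} F A : rename.
Arguments fmap {C D} F {A B} f : rename.
Arguments fmap_id {C D} F A : rename.
Arguments fmap_comp {C D} F {A B E} g f : rename.

Program Definition fcomp {C D E : Category} (G : Functor D E) (F : Functor C D)
    : Functor C E :=
  {| fobj := fun A => G (F A); fmap := fun A B f => fmap G (fmap F f) |}.
Next Obligation. now intros; simpl; rewrite !fmap_id. Qed.
Next Obligation. now intros; simpl; rewrite !fmap_comp. Qed.

Notation "G ∘F F" := (fcomp G F) (at level 40, left associativity).

(** The category of sets: its objects are the types of one fixed universe, with
    Leibniz equality on elements and on functions. *)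
Definition SET : Category := {|
  Obj := Type;
  Hom := fun A B => A -> B;
  idm := fun A x => x;
  comp := fun A B C g f x => g (f x);
  comp_idl := fun A B f => eq_refl;
  comp_idr := fun A B f => eq_refl;
  comp_assoc := fun A B C D h g f => eq_refl
|}.

Record Monad := {
  monad_functor :> Functor SET SET;
  eta : forall X : SET, Hom X (monad_functor X);
  mu : forall X : SET, Hom (monad_functor (monad_functor X)) (monad_functor X);
  eta_natural : forall (X Y : SET) (f : Hom X Y),
    eta Y ∘ f = fmap monad_functor f ∘ eta X;
  mu_natural : forall (X Y : SET) (f : Hom X Y),
    mu Y ∘ fmap monad_functor (fmap monad_functor f)
    = fmap monad_functor f ∘ mu X;
  mu_eta : forall X : SET, mu X ∘ eta (monad_functor X) = idm (monad_functor X);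
  mu_fmap_eta : forall X : SET,
    mu X ∘ fmap monad_functor (eta X) = idm (monad_functor X);
  mu_mu : forall X : SET,
    mu X ∘ mu (monad_functor X) = mu X ∘ fmap monad_functor (mu X)
}.

Record Algebra (T : Monad) := {
  alg_carrier : SET;
  alg_str : Hom (T alg_carrier) alg_carrier;
  alg_mu : alg_str ∘ mu T alg_carrier = alg_str ∘ fmap T alg_str;
  alg_eta : alg_str ∘ eta T alg_carrier = idm alg_carrier
}.
Arguments alg_carrier {T} A : rename.
Arguments alg_str {T} A : rename.

Record AlgHom {T : Monad} (A B : Algebra T) := {
  alg_map : Hom (alg_carrier A) (alg_carrier B);
  alg_map_str : alg_map ∘ alg_str A = alg_str B ∘ fmap T alg_map
}.
Arguments alg_map {T A B} h : rename.
Arguments alg_map_str {T A B} h : rename.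

Lemma AlgHom_eq {T : Monad} (A B : Algebra T) (h k : AlgHom A B) :
  alg_map h = alg_map k -> h = k.
Proof.
destruct h as [h hP], k as [k kP]; simpl; intros e; destruct e.
now rewrite (proof_irrelevance _ hP kP).
Qed.

Program Definition AlgHom_id {T : Monad} (A : Algebra T) : AlgHom A A :=
  {| alg_map := idm (alg_carrier A) |}.
Next Obligation. now intros T A; rewrite fmap_id. Qed.

Program Definition AlgHom_comp {T : Monad} (A B C : Algebra T)
    (k : AlgHom B C) (h : AlgHom A B) : AlgHom A C :=
  {| alg_map := alg_map k ∘ alg_map h |}.
Next Obligation.
intros T A B C k h.
now rewrite fmap_comp, comp_assoc, <- alg_map_str, <- !comp_assoc, alg_map_str.
Qed.

Program Definition EM (T : Monad) : Category := {|
  Obj := Algebra T;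
  Hom := AlgHom;
  idm := AlgHom_id;
  comp := AlgHom_comp
|}.
Next Obligation. now intros; apply AlgHom_eq. Qed.
Next Obligation. now intros; apply AlgHom_eq. Qed.
Next Obligation. now intros; apply AlgHom_eq. Qed.

Definition forget (T : Monad) : Functor (EM T) SET := {|
  fobj := fun A : EM T => alg_carrier A;
  fmap := fun (A B : EM T) (h : Hom A B) => alg_map h;
  fmap_id := fun A => eq_refl;
  fmap_comp := fun A B C k h => eq_refl
|}.

Definition free_alg (T : Monad) (X : SET) : Algebra T := {|
  alg_carrier := T X;
  alg_str := mu T X;
  alg_mu := mu_mu T X;
  alg_eta := mu_eta T X
|}.

(** Equality of functors is Leibniz equality of records: the functor laws are
    proofs and do not matter by proof irrelevance, while equality of the object
    maps is extensional by functional extensionality. *)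
Record AlgebraLifting (T : Monad) (F : Functor SET SET) := {
  lift_functor :> Functor (EM T) (EM T);
  lift_forget : forget T ∘F lift_functor = F ∘F forget T
}.
Arguments lift_functor {T F} L : rename.
Arguments lift_forget {T F} L : rename.

Definition lift_carrier {T : Monad} {F : Functor SET SET}
    (L : AlgebraLifting T F) (A : Algebra T) :
    alg_carrier (L A) = F (alg_carrier A) :=
  f_equal (fun G : Functor (EM T) SET => G A) (lift_forget L).

(** The algebra [L A] has carrier [F A] only up to the equality [lift_carrier],
    so its structure map is transported to one on [F A]. *)
Definition lift_str {T : Monad} {F : Functor SET SET}
    (L : AlgebraLifting T F) (A : Algebra T) :
    Hom (T (F (alg_carrier A))) (F (alg_carrier A)) :=
  eq_rect (alg_carrier (L A)) (fun Z : SET => Hom (T Z) Z) (alg_str (L A))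
    (F (alg_carrier A)) (lift_carrier L A).

Record Coalgebra (G : Functor SET SET) := {
  coalg_carrier :> SET;
  coalg_str : Hom coalg_carrier (G coalg_carrier)
}.
Arguments coalg_carrier {G} X : rename.
Arguments coalg_str {G} X : rename.

Record CoalgHom {G : Functor SET SET} (X Y : Coalgebra G) := {
  coalg_map : Hom X Y;
  coalg_map_str : coalg_str Y ∘ coalg_map = fmap G coalg_map ∘ coalg_str X
}.
Arguments coalg_map {G X Y} h : rename.
Arguments coalg_map_str {G X Y} h : rename.

(** [beh Z X] is the unique map into the final coalgebra; uniqueness is stated
    on underlying functions. *)
Record FinalCoalgebra (G : Functor SET SET) := {
  final_coalg :> Coalgebra G;
  beh : forall X : Coalgebra G, CoalgHom X final_coalg;
  beh_unique : forall (X : Coalgebra G) (h : CoalgHom X final_coalg),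
    coalg_map h = coalg_map (beh X)
}.
Arguments final_coalg {G} Z : rename.
Arguments beh {G} Z X : rename.
Arguments beh_unique {G} Z {X} h : rename.

Definition beh_equiv {G : Functor SET SET} (Z : FinalCoalgebra G)
    (X Y : Coalgebra G) (x : coalg_carrier X) (y : coalg_carrier Y) : Prop :=
  coalg_map (beh Z X) x = coalg_map (beh Z Y) y.

Definition sharp {T : Monad} {F : Functor SET SET} (L : AlgebraLifting T F)
    (X : Coalgebra (F ∘F T)) : Hom (T X) (F (T X)) :=
  lift_str L (free_alg T X) ∘ fmap T (coalg_str X).

Definition sharp_coalg {T : Monad} {F : Functor SET SET}
    (L : AlgebraLifting T F) (X : Coalgebra (F ∘F T)) : Coalgebra F :=
  {| coalg_carrier := T X; coalg_str := sharp L X |}.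

Definition lifted_equiv {T : Monad} {F : Functor SET SET}
    (L : AlgebraLifting T F) (Z : FinalCoalgebra F)
    (X Y : Coalgebra (F ∘F T)) (x : coalg_carrier X) (y : coalg_carrier Y) : Prop :=
  beh_equiv Z (sharp_coalg L X) (sharp_coalg L Y) (eta T X x) (eta T Y y).

(* Main.v *)
(** If [h] is an [FT]-homomorphism, then [T h] is an [F]-homomorphism between the
    determinized coalgebras, because [F (T h)] is a homomorphism of the lifted
    algebras. Hence the behaviour of [eta x] is the image of [h (x)], for [h] the
    map into the final [FT]-coalgebra, under a map that depends only on that
    coalgebra. *)
Require Import Defs.

(* The equation between functors is generalized so that it can be eliminated:
   its right-hand side [F ∘F forget T] is not a variable. *)
Lemma transported_str_natural (T : Monad) (L : Functor (EM T) (EM T))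
    (G : Functor (EM T) SET) (e : forget T ∘F L = G)
    (str := fun A : EM T =>
      eq_rect (alg_carrier (L A)) (fun Z : SET => @Hom SET (T Z) Z)
        (alg_str (L A)) (G A)
        (f_equal (fun G' : Functor (EM T) SET => G' A) e))
    (A B : EM T) (k : Hom A B) :
  fmap G k ∘ str A = str B ∘ fmap T (fmap G k).
Proof.
destruct e.
exact (alg_map_str (fmap L k)).
Qed.

(** The equality [lift_forget L] also covers morphisms: the algebra homomorphism [fmap L k] lies
    over [fmap F (alg_map k)], up to the transport along carriers. *)
Lemma lift_str_natural (T : Monad) (F : Functor SET SET)
    (L : AlgebraLifting T F) (A B : Algebra T) (k : AlgHom A B) :
  fmap F (alg_map k) ∘ lift_str L A
  = lift_str L B ∘ fmap T (fmap F (alg_map k)).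
Proof. exact (transported_str_natural T L _ (lift_forget L) A B k). Qed.

Definition free_hom (T : Monad) (X Y : SET) (h : Hom X Y) :
    AlgHom (free_alg T X) (free_alg T Y) :=
  {| alg_map := (fmap T h : Hom (alg_carrier (free_alg T X))
                                (alg_carrier (free_alg T Y)));
     alg_map_str := eq_sym (mu_natural T X Y h) |}.

Lemma sharp_natural (T : Monad) (F : Functor SET SET) (L : AlgebraLifting T F)
    (X Y : Coalgebra (F ∘F T)) (h : CoalgHom X Y) :
  sharp L Y ∘ fmap T (coalg_map h)
  = fmap F (fmap T (coalg_map h)) ∘ sharp L X.
Proof.
unfold sharp.
rewrite <- comp_assoc, <- fmap_comp, coalg_map_str, fmap_comp, !comp_assoc.
(* Functoriality of [T] and the homomorphism law of [h] have left a common right factor. What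
   remains is that [F (T h)] respects the lifted structures, which holds because [T h] is a
   homomorphism of free algebras. *)
apply (f_equal (fun u => u ∘ fmap T (coalg_str X))).
exact (eq_sym (lift_str_natural T F L _ _ (free_hom T X Y (coalg_map h)))).
Qed.

Definition sharp_hom (T : Monad) (F : Functor SET SET) (L : AlgebraLifting T F)
    (X Y : Coalgebra (F ∘F T)) (h : CoalgHom X Y) :
    CoalgHom (sharp_coalg L X) (sharp_coalg L Y) :=
  {| coalg_map := (fmap T (coalg_map h) : Hom (coalg_carrier (sharp_coalg L X))
                                        (coalg_carrier (sharp_coalg L Y)));
     coalg_map_str := sharp_natural T F L X Y h |}.

Lemma beh_coalg_map (G : Functor SET SET) (Z : FinalCoalgebra G)
    (X Y : Coalgebra G) (h : CoalgHom X Y) :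
  coalg_map (beh Z Y) ∘ coalg_map h = coalg_map (beh Z X).
Proof.
assert (e : coalg_str Z ∘ (coalg_map (beh Z Y) ∘ coalg_map h)
            = fmap G (coalg_map (beh Z Y) ∘ coalg_map h) ∘ coalg_str X).
{ now rewrite fmap_comp, comp_assoc, coalg_map_str, <- !comp_assoc,
    coalg_map_str. }
exact (beh_unique Z {| coalg_map := _; coalg_map_str := e |}).
Qed.

(** The homomorphism [sharp_hom] preserves behaviour, and by naturality of [eta] it sends [eta x] to
    [eta (h x)]. *)
Lemma beh_sharp_eta (T : Monad) (F : Functor SET SET) (L : AlgebraLifting T F)
    (Z : FinalCoalgebra F) (X Y : Coalgebra (F ∘F T)) (h : CoalgHom X Y)
    (x : coalg_carrier X) :
  coalg_map (beh Z (sharp_coalg L X)) (eta T X x)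
  = coalg_map (beh Z (sharp_coalg L Y)) (eta T Y (coalg_map h x)).
Proof.
rewrite <- (beh_coalg_map F Z _ _ (sharp_hom T F L X Y h)).
apply (f_equal (coalg_map (beh Z (sharp_coalg L Y)))).
exact (eq_sym (f_equal (fun u => u x) (eta_natural T X Y (coalg_map h)))).
Qed.

Theorem theorem1 (T : Monad) (F : Functor SET SET)
    (ZF : FinalCoalgebra F) (L : AlgebraLifting T F)
    (ZFT : FinalCoalgebra (F ∘F T))
    (X Y : Coalgebra (F ∘F T))
    (x : coalg_carrier X) (y : coalg_carrier Y) :
  beh_equiv ZFT X Y x y -> lifted_equiv L ZF X Y x y.
Proof.
unfold lifted_equiv, beh_equiv; intros xy.
rewrite (beh_sharp_eta T F L ZF X ZFT (beh ZFT X) x).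
rewrite (beh_sharp_eta T F L ZF Y ZFT (beh ZFT Y) y).
now rewrite xy.
Qed.
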